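(* Let $S$ and $T$ be trees of height $\omega_1$ with $S\le T$. Then: (i) $NS^T\le_K NS^S$, and (ii) if $S$ is a nonspecial $\omega_1$-tree, then $\diamondsuit_S$ implies $\diamondsuit_T$.
   Context: A tree is a partial order $(T,<_T)$ in which the set of predecessors of each node is well-ordered; every tree is assumed to have a root, denoted $\emptyset$. For $t\in T$, $t{\downarrow}=\{s\in T\mid s<_T t\}$, $\mathrm{ht}(t)$ is the order type of $t{\downarrow}$, and $T_\alpha$ is the set of nodes of height $\alpha$. The height of $T$ is the least $\alpha$ with $T_\alpha=\emptyset$. An $\omega_1$-tree is a tree of height $\omega_1$ all of whose levels $T_\alpha$ are countable. For trees $S,T$, write $S\le T$ if there is a strictly increasing map $g:S\to T$, i.e. $s<_S t$ implies $g(s)<_T g(t)$. An antichain is a set of pairwise incomparable nodes. A set $U\subseteq T$ is special if it is a union of at most countably many antichains; otherwise it is nonspecial. (If $S\le T$ and $S$ is nonspecial then $T$ is nonspecial, so $\diamondsuit_T$ makes sense in (ii).) For $X\subseteq T$, a map $f:X\to T$ is regressive if $f(t)<_T t$ for all $t\in X\setminus\{\emptyset\}$. For $T$ of height $\omega_1$, $NS^T$ is the ideal of all $B\subseteq T$ for which there is a regressive $f:B\to T$ such that $f^{-1}(\{t\})$ is special for every $t\in T$. Katětov order: for ideals $\mathcal I$ on $X$ and $\mathcal J$ on $Y$ (ideals are nonempty families closed under subsets and finite unions, not required to be proper), $\mathcal I\le_K\mathcal J$ means that there is $f:Y\to X$ with $f^{-1}(A)\in\mathcal J$ for all $A\in\mathcal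 I$. For a nonspecial tree $T$ of height $\omega_1$, $\diamondsuit_T$ asserts that there is a sequence $(D_t\mid t\in T)$ with $D_t\subseteq t{\downarrow}$ for all $t\in T$ such that for every $X\subseteq T$, $\{t\in T\mid X\cap t{\downarrow}=D_t\}\notin NS^T$. *)

(* Defs.v *)
Set Warnings "-notation-overridden,-notation-incompatible-prefix".
From mathcomp Require Import all_boot all_order.
From mathcomp Require Import boolp classical_sets functions cardinality wochoice.

Set Implicit Arguments.
Unset Strict Implicit.
Unset Printing Implicit Defensive.

Import Order.TTheory.

Local Open Scope order_scope.
Local Open Scope classical_set_scope.

Definition below {d} {T : porderType d} (t : T) : set T := [set s | s < t].

(* The root of a tree is the least element [\bot] of the [bPOrderType]. *)
Definition is_tree {d} (T : bPOrderType d) : Prop :=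
  forall t : T, wo_chain (<=%O : rel T) [pred s | s < t].

(* An ordinal is represented either by a well-ordered type [W] (as the set
   [setT]), or by an initial segment [below w] of one.  The isomorphism goes
   from the ordinal to the tree, and the tree is inhabited by its root, so that
   the empty ordinal needs no special treatment. *)
Definition has_order_type {d d'} {W : orderType d} {T : bPOrderType d'}
    (A : set W) (B : set T) : Prop :=
  exists g : W -> T,
    set_bij A B g /\ {in A &, {mono g : x y / x < y}}.

Definition level {d d'} (T : bPOrderType d') {W : orderType d} (A : set W) :
    set T :=
  [set t | has_order_type A (below t)].
Arguments level {d d'} T {W} A.

(* [W] is the least ordinal whose level is empty. *)
Definition has_height {d d'} (T : bPOrderType d') (W : orderType d) : Prop :=
  level T [set: W] = set0 /\ forall w : W, level T (below w) !=set0.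

(* The least uncountable ordinal. *)
Definition is_omega1 {d} (W : orderType d) : Prop :=
  [/\ well_order (<=%O : rel W),
      ~ countable [set: W] &
      forall w : W, countable (below w)].

Definition has_height_omega1 {d} (T : bPOrderType d) : Prop :=
  exists (d' : Order.disp_t) (W : orderType d'), is_omega1 W /\ has_height T W.

Definition is_omega1_tree {d} (T : bPOrderType d) : Prop :=
  [/\ is_tree T,
      has_height_omega1 T &
      forall (d' : Order.disp_t) (W : orderType d'),
        well_order (<=%O : rel W) -> countable (level T [set: W])].

Definition tree_le {d d'} (S : bPOrderType d) (T : bPOrderType d') : Prop :=
  exists g : S -> T, {homo g : s t / s < t}.

Definition antichain {d} {T : porderType d} (A : set T) : Prop :=
  forall s t, A s -> A t -> s <> t -> s >< t.

Definition special {d} {T : porderType d} (U : set T) : Prop :=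
  exists F : set (set T),
    [/\ countable F, F `<=` antichain & U = \bigcup_(A in F) A].

Definition nonspecial {d} {T : porderType d} (U : set T) : Prop := ~ special U.

(* A map [X -> T] is given by any total extension; only its values on [X]
   matter. *)
Definition regressive {d} {T : bPOrderType d} (X : set T) (f : T -> T) : Prop :=
  forall t, X t -> t <> \bot -> f t < t.

Record ideal (X : Type) := Ideal {
  ideal_sets : set (set X);
  ideal_nonempty : ideal_sets !=set0;
  ideal_subset : forall A B, A `<=` B -> ideal_sets B -> ideal_sets A;
  ideal_setU : forall A B, ideal_sets A -> ideal_sets B -> ideal_sets (A `|` B)
}.

Definition katetov_le {X Y : Type} (I : ideal X) (J : ideal Y) : Prop :=
  exists f : Y -> X, forall A, ideal_sets I A -> ideal_sets J (f @^-1` A).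

Section NS.
Context {d : Order.disp_t} (T : bPOrderType d).
Implicit Types A B U V : set T.

Definition NS_sets : set (set T) :=
  [set B | exists f : T -> T,
    regressive B f /\ forall t, special (B `&` f @^-1` [set t])].

Lemma antichain_subset A B : A `<=` B -> antichain B -> antichain A.
Proof. by move=> sAB acB s t As At; apply: acB; apply: sAB. Qed.

Lemma special_subset U V : U `<=` V -> special V -> special U.
Proof.
move=> sUV [F [cF acF VE]]; exists [set U `&` A | A in F]; split.
- exact: sub_countable (card_image_le _ _) cF.
- by move=> _ [A /acF acA <-]; apply: antichain_subset acA => ? [].
- apply/seteqP; split=> [t Ut|t [_ [A FA <-] []]//].
  have := sUV t Ut; rewrite VE => -[A FA At].
  by exists (U `&` A); [exists A|].
Qed.

Lemma special_setU U V : special U -> special V -> special (U `|` V).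
Proof.
move=> [F [cF acF ->]] [G [cG acG ->]]; exists (F `|` G); split.
- by rewrite -bigcup2E; apply: bigcup_countable => // -[|[|n]] _ //=.
- by move=> A [/acF|/acG].
- by rewrite bigcup_setU.
Qed.

Lemma NS_nonempty : NS_sets !=set0.
Proof.
exists set0, id; split=> // t; exists set0; split=> //.
by rewrite set0I bigcup_set0.
Qed.

Lemma NS_subset A B : A `<=` B -> NS_sets B -> NS_sets A.
Proof.
move=> sAB [f [rf sf]]; exists f; split=> [t /sAB|t]; first exact: rf.
by apply: special_subset (sf t); apply: setSI.
Qed.

Lemma NS_setU A B : NS_sets A -> NS_sets B -> NS_sets (A `|` B).
Proof.
move=> [f [rf sf]] [g [rg sg]].
exists (fun t => if t \in A then f t else g t); split=> [t|t].
  by case: ifPn => [/set_mem At _|/negP nAt [/mem_set//|Bt]]; [exact: rf|exact: rg].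
apply: special_subset (special_setU (sf t) (sg t)) => s [ABs] /=.
by case: ifPn => [/set_mem As fs|/negP nAs gs]; [left|right; case: ABs => [/mem_set|]].
Qed.

End NS.

Definition NS {d} (T : bPOrderType d) : ideal T :=
  Ideal (NS_nonempty T) (@NS_subset d T) (@NS_setU d T).

(* Nonspeciality of [T] need not be required: if [T] is special, then every
   set is in [NS T] (witnessed by the constant map to the root), so that
   [diamond T] fails. *)
Definition diamond {d} (T : bPOrderType d) : Prop :=
  exists D : T -> set T,
    (forall t, D t `<=` below t) /\
    forall X : set T, ~ ideal_sets (NS T) [set t | X `&` below t = D t].

(* Main.v *)
(* A strictly increasing map [S -> T] can be lowered to a height-preserving one
   [h], which maps the predecessors of [s] onto those of [h s].  A regressive map
   [f] on [B] then lifts along [h] to a regressive map on [h @^-1` B], with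
   fibres inside preimages of fibres of [f]; so [h] witnesses the Katetov
   reduction.  If the levels of [S] are countable, the sets [h @` D s] with
   [h s = t] give countably many guesses at [t], and every [X] is guessed on an
   [NS]-positive set.  As for the equivalence of diamond and its weak form on
   [omega_1], coding a sequence of sets into a single one shows that the [n]-th
   guesses form a diamond sequence for some [n]. *)
Require Import Defs.
Set Warnings "-notation-overridden,-notation-incompatible-prefix".
From mathcomp Require Import all_boot all_order.
From mathcomp Require Import boolp classical_sets functions cardinality.
From HB Require Import structures.
From mathcomp Require Import wochoice.

Set Implicit Arguments.
Unset Strict Implicit.
Unset Printing Implicit Defensive.

Import Order.TTheory.

Local Open Scope order_scope.
Local Open Scope classical_set_scope.

(** * Induction, recursion and coding of pairs in trees *)

Section Tree.
Context {d : Order.disp_t} {T : bPOrderType d} (treeT : is_tree T).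
Implicit Types (s t u : T) (A : set T).

Lemma tree_min_lt t A : A `<=` below t -> A !=set0 ->
  exists2 x, A x & forall y, A y -> x <= y.
Proof.
move=> At [a Aa].
have [||x [[]]] := treeT (t := t) (A := [pred x | `[< A x >]]).
- by move=> x /asboolP /At.
- by exists a; apply/asboolP.
by move=> /asboolP Ax xle _; exists x => // y Ay; apply: xle; apply/asboolP.
Qed.

Lemma tree_min t A : (forall x, A x -> x <= t) -> A !=set0 ->
  exists2 x, A x & forall y, A y -> x <= y.
Proof.
move=> At [a Aa]; have [[b [Ab bt]]|nA] := pselect (A `&` below t !=set0).
  have [||x [Ax xt] xle] := @tree_min_lt t (A `&` below t).
  - by move=> x [].
  - by exists b.
  exists x => // y Ay; have := At y Ay; rewrite le_eqVlt => /orP[/eqP ->|yt].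
    exact: ltW.
  by apply: xle.
have AE x : A x -> x = t.
  move=> Ax; have := At x Ax; rewrite le_eqVlt => /orP[/eqP //|xt].
  by case: nA; exists x.
by exists a => // y /AE ->; apply: At.
Qed.

Lemma tree_comparable t s u : s <= t -> u <= t -> s >=< u.
Proof.
move=> st ut; have [||x sux xle] := @tree_min t [set x | x = s \/ x = u].
- by move=> x [] ->.
- by exists s; left.
by case: sux xle => -> xle; [apply: le_comparable|apply: ge_comparable];
  apply: xle; [right|left].
Qed.

Lemma tree_ltVge t s u : s <= t -> u <= t -> s < u \/ u <= s.
Proof. by move=> st ut; case: (comparable_leP (tree_comparable ut st)); [right|left]. Qed.

Lemma tree_ind (P : T -> Prop) :
  (forall t, (forall s, s < t -> P s) -> P t) -> forall t, P t.
Proof.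
move=> IH t; apply: contrapT => nPt.
have [||x [xt nPx] xle] := @tree_min t [set x | x <= t /\ ~ P x].
- by move=> x [].
- by exists t.
apply/nPx/IH => s sx; apply: contrapT => nPs.
by have := lt_le_trans sx (xle s (conj (le_trans (ltW sx) xt) nPs)); rewrite ltxx.
Qed.

Lemma tree_rec (A : Type) (a : A) (F : T -> (T -> A) -> A) :
    (forall t f g, (forall s, s < t -> f s = g s) -> F t f = F t g) ->
  exists h : T -> A, forall t, h t = F t h.
Proof.
move=> extF.
have wf : well_founded (fun s t => s < t).
  by apply: tree_ind => t IH; constructor.
(* The default [a] is harmless: by [extF], [F t] depends only on values below [t]. *)
pose G t (rec : forall s, s < t -> A) :=
  F t (fun s => if pselect (s < t) is left p then rec s p else a).
exists (Fix wf (fun _ => A) G) => t; rewrite Fix_eq => [|u f g fg].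
  by apply: extF => s st; case: pselect.
by apply: extF => s su; case: pselect.
Qed.

(** The root satisfies this vacuously, so it counts as a limit. *)
Definition limit_node t := forall s, s < t -> exists2 u, s < u & u < t.

Lemma nlimit_nodeP t : ~ limit_node t -> exists2 p, p < t & forall s, s < t -> s <= p.
Proof.
move=> nl; apply: contrapT => np; apply: nl => p pt; apply: contrapT => nu.
apply: np; exists p => // s st.
have [ps|//] := tree_ltVge (ltW pt) (ltW st).
by case: nu; exists s.
Qed.

Lemma tree_predecessor : exists p : T -> T, forall t, ~ limit_node t ->
  p t < t /\ forall s, s < t -> s <= p t.
Proof.
have /choice[p pP] : forall t, exists p, ~ limit_node t ->
    p < t /\ forall s, s < t -> s <= p.
  move=> t; have [l|/nlimit_nodeP[p ? ?]] := pselect (limit_node t).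
    by exists t.
  by exists p.
by exists p.
Qed.

(* A node of height [lambda + n], with [lambda] limit or zero, gets rank [n]. *)
Lemma tree_finite_rank : exists (p : T -> T) (rk : T -> nat),
  forall s t, limit_node t -> s < t ->
    exists u, [/\ u < t, p u = s & rk u = (rk s).+1].
Proof.
have [p pP] := tree_predecessor.
have [|rk rkE] := @tree_rec nat 0
  (fun t f => if `[< limit_node t >] then 0 else (f (p t)).+1).
  move=> t f g fg; by case: asboolP => // /pP[pt _]; rewrite fg.
exists p, rk => s t lt_t st.
(* [u] is the successor of [s] on the way to [t]; it stays below [t] because [t] is a limit. *)
have [||u [su ut] ule] := @tree_min t [set x | s < x /\ x <= t].
- by move=> x [].
- by exists t.
have {}ut : u < t.
  have [v sv vt] := lt_t s st; apply: (le_lt_trans _ vt); apply: ule.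
  by split=> //; apply: ltW.
have nu : ~ limit_node u.
  move=> /(_ s su)[v sv vu].
  by have := lt_le_trans vu (ule v (conj sv (ltW (lt_trans vu ut)))); rewrite ltxx.
have [pu ltp] := pP u nu.
have puE : p u = s.
  apply/eqP; rewrite eq_le ltp // andbT.
  have [spu|//] := tree_ltVge (ltW st) (ltW (lt_trans pu ut)).
  by have := lt_le_trans pu (ule _ (conj spu (ltW (lt_trans pu ut)))); rewrite ltxx.
by exists u; split=> //; rewrite rkE asboolF // puE.
Qed.

(* The pair [(s, n)] is coded, below each limit node [t] above [s], by the node
   of rank [code (rank s, n)] reached from [s] on the way to [t]. *)
Lemma tree_decoding : exists (a : T -> T) (b : T -> nat),
  forall s t n, limit_node t -> s < t ->
    exists u, [/\ u < t, a u = s & b u = n].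
Proof.
have [p [rk prkP]] := tree_finite_rank.
pose c u := CodeSeq.decode (rk u).
(* The decoded list starts with the rank of [s], so the excess of [rk u] over it counts the steps by
   [p] leading back to [s]. *)
exists (fun u => iter (rk u - head 0 (c u)) p u), (fun u => nth 0 (c u) 1).
move=> s t n lt_t st.
have up m : exists u, [/\ u < t, iter m p u = s & rk u = (m + rk s)%N].
  elim: m => [|m [u [ut pu rku]]]; first by exists s.
  have [v [vt pv rkv]] := prkP u t lt_t ut.
  by exists v; rewrite iterSr pv rkv rku.
pose k := CodeSeq.code [:: rk s; n].
(* A code exceeds its entries, so rank [k] is reached by going up from [s]. *)
have sk : (rk s < k)%N by have /andP[] := CodeSeq.ltn_code [:: rk s; n].
have [u [ut pu rku]] := up (k - rk s)%N.
have {}rku : rk u = k by rewrite rku subnK // ltnW.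
by exists u; rewrite /c rku CodeSeq.codeK.
Qed.

End Tree.

(** * The predecessors of a node as an ordinal *)

Section Below.
Context {d : Order.disp_t} {T : bPOrderType d} (treeT : is_tree T) (t : T).

Local Notation B := (sub_type {x : T | x < t} : porderType d).

Lemma below_total : total (<=%O : rel B).
Proof.
by move=> x y;
  exact: (tree_comparable treeT (ltW (valP x)) (ltW (valP y))).
Qed.

Definition below_order : orderType d :=
  HB.pack_for (orderType d) B (Order.POrder_isTotal.Build d _ below_total).

Lemma below_order_wo : well_order (<=%O : rel below_order).
Proof.
apply: antisymmetric_well_order => [|A [a Aa]]; first exact: le_anti.
have [||_ [x Ax <-] xle] := tree_min_lt (t := t) treeT (A := (val : B -> T) @` [set x | x \in A]).
- by move=> _ [x _ <-]; exact: (valP x).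
- by exists (val a), a.
by exists x; split=> // y Ay; apply: xle; exists y.
Qed.

End Below.

(** * Countable unions, limit nodes and countably many guesses *)

Section Ideals.
Context {d : Order.disp_t} {T : bPOrderType d}.
Implicit Types (U A : set T).

Lemma special_antichain A : antichain A -> special A.
Proof.
move=> acA; exists [set A]; split; rewrite ?bigcup_set1 //.
by move=> _ ->.
Qed.

Lemma special_bigcup (U : nat -> set T) :
  (forall n, special (U n)) -> special (\bigcup_n U n).
Proof.
move=> /choice[F FP]; exists (\bigcup_n F n); split.
- by apply: bigcup_countable => // n _; case: (FP n).
- by move=> A [n _]; case: (FP n) => _ acF _; apply: acF.
- by rewrite bigcup_bigcup; apply: eq_bigcupr => n _; case: (FP n).
Qed.

(** Glue the regressive maps by choosing one index per node; each fibre is covered by the countably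
    many original fibres. *)
Lemma NS_bigcup (B : nat -> set T) :
  (forall n, NS_sets (B n)) -> NS_sets (\bigcup_n B n).
Proof.
move=> /choice[f fP].
have /choice[k kP] : forall t, exists k, (\bigcup_n B n) t -> B k t.
  move=> t; have [[n _ Bt]|nB] := pselect ((\bigcup_n B n) t); first by exists n.
  by exists 0.
exists (fun t => f (k t) t); split=> [t Bt|t].
  by case: (fP (k t)) => rf _; apply: rf; apply: kP.
have := @special_bigcup (fun n => B n `&` f n @^-1` [set t]) (fun n => (fP n).2 t).
by apply: special_subset => s [/kP Bs /= fs]; exists (k s).
Qed.

(** Comparable nodes with the same immediate predecessor coincide, so the predecessor map has
    antichain fibres. *)
Lemma NS_nlimit : is_tree T -> NS_sets [set t : T | ~ limit_node t].
Proof.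
move=> treeT; have [p pP] := tree_predecessor treeT.
exists p; split=> [t nl _|t]; first by have [] := pP t nl.
apply: special_antichain => s u [/pP[ps les] /= psE] [/pP[pu leu] /= puE] /eqP su.
apply/negP => /comparable_ltgtP cmp; case: cmp su => // [lt_su|lt_us] _.
  by have := lt_le_trans ps (leu s lt_su); rewrite psE puE ltxx.
by have := lt_le_trans pu (les u lt_us); rewrite psE puE ltxx.
Qed.

(* If every [D n] failed with witness [X n], the set coding all the [X n] would
   be guessed by [A] only on a set in [NS]. *)
Lemma diamond_countable (A : T -> nat -> set T) : is_tree T ->
    (forall X, ~ NS_sets [set t | exists n, X `&` below t = A t n]) ->
  diamond T.
Proof.
move=> treeT AP; have [a [b abP]] := tree_decoding treeT.
(* The guess [A t n] is decoded, keeping the nodes [s] whose pair [(s, n)] is coded in it. *)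
pose D n t := [set s | s < t /\
  exists u, [/\ u < t, A t n u, a u = s & b u = n]].
apply: contrapT => nd.
have /choice[X NX] : forall n, exists X, NS_sets [set t | X `&` below t = D n t].
  move=> n; apply: contrapT => nX; apply: nd; exists (D n).
  by split=> [t s []//|X NX]; apply: nX; exists X.
pose Y := [set u | X (b u) (a u)].
(* At a limit [t], if [A t n] guesses [Y], then [D n t] guesses [X n], which happens only on a set
   in [NS]; the other nodes are negligible. *)
apply: (AP Y); apply: NS_subset (NS_setU (NS_nlimit treeT) (NS_bigcup NX)).
move=> t [n YE]; have [lt_t|] := pselect (limit_node t); last by left.
right; exists n => //=; apply/seteqP; split=> s.
  move=> [Xs st]; split=> //; have [u [ut us un]] := abP s t n lt_t st.
  by exists u; split=> //; rewrite -YE; split=> //; rewrite /Y /= us un.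
by move=> [st [u [ut]]]; rewrite -YE => -[Yu _] us un; split=> //; rewrite -us -un.
Qed.

End Ideals.

(** * Height-preserving maps and the transfer of diamond *)

Section LevelMap.
Context {d d' : Order.disp_t} {S : bPOrderType d} {T : bPOrderType d'}.

Lemma special_preimage (h : S -> T) (U : set T) :
  {homo h : s t / s < t} -> special U -> special (h @^-1` U).
Proof.
move=> hlt [F [cF acF ->]]; exists [set h @^-1` A | A in F]; split.
- exact: sub_countable (card_image_le _ _) cF.
- move=> _ [A /acF acA <-].
  have nlt x y : A (h x) -> A (h y) -> ~ x < y.
    move=> Ax Ay /hlt hxy; have /negP[] := acA _ _ Ax Ay (elimN eqP (negbT (lt_eqF hxy))).
    exact: lt_comparable.
  move=> s t As At /eqP st; apply/negP => /comparable_ltgtP cmp.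
  by case: cmp st => // lt_st _; [apply: nlt lt_st|apply: nlt lt_st].
- by rewrite preimage_bigcup bigcup_image.
Qed.

(* [h] preserves heights. *)
Definition level_map (h : S -> T) :=
  {homo h : s t / s < t} /\ forall s x, x < h s -> exists2 r, r < s & h r = x.

(* Send [s] to the predecessor-or-equal of [g s] at the height of [s]. *)
Lemma tree_le_level_map : is_tree S -> is_tree T -> tree_le S T ->
  exists h : S -> T, level_map h.
Proof.
move=> treeS treeT [g glt].
(* [h s] will be the least candidate. As [h r <= g r < g s] for [r < s], [g s] is one, so the
   default of [xget] does not matter. *)
pose C s (f : S -> T) := [set x | x <= g s /\ forall r, r < s -> f r < x].
pose M s f := [set x | C s f x /\ forall y, C s f y -> x <= y].
have [|h hE] := @tree_rec _ _ treeS T \bot (fun s f => xget (g s) (M s f)).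
  move=> s f f' ff'; suff -> : M s f = M s f' by [].
  suff CE : C s f = C s f' by rewrite /M CE.
  apply/seteqP; split=> x [xs fx]; split=> // r rs.
    by rewrite -ff' //; apply: fx.
  by rewrite ff' //; apply: fx.
have hP : forall s, M s h (h s).
  apply: (tree_ind treeS) => s IH; rewrite [h s]hE.
  have [||x Cx xle] := @tree_min _ _ treeT (g s) (C s h).
  - by move=> x [].
  - exists (g s); split=> // r rs; apply: le_lt_trans (glt _ _ rs).
    by case: (IH r rs) => -[].
  exact: (@xgetI _ _ (M s h) x).
have hlt : {homo h : s t / s < t} by move=> s t st; case: (hP t) => -[_ H] _; apply: H.
exists h; split=> //; apply: (tree_ind treeS) => s IH x xs.
have [[hs _] hmin] := hP s.
have xgs : x <= g s := le_trans (ltW xs) hs.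
(* By minimality of [h s], the smaller [x] is no candidate, so some earlier value is not below
   [x]. *)
have [r rs nrx] : exists2 r, r < s & ~ h r < x.
  apply: contrapT => nr; have /(lt_le_trans xs) : h s <= x; last by rewrite ltxx.
  apply: hmin; split=> // r rs; apply: contrapT => nrx.
  by apply: nr; exists r.
have [//|] := tree_ltVge treeT (ltW (lt_le_trans (hlt _ _ rs) hs)) xgs.
rewrite le_eqVlt => /orP[/eqP ->|xr]; first by exists r.
by have [q qr qx] := IH r rs x xr; exists q => //; apply: lt_trans rs.
Qed.

Lemma NS_preimage (h : S -> T) (A : set T) :
  level_map h -> NS_sets A -> NS_sets (h @^-1` A).
Proof.
move=> [hlt hon] [f [rf sf]].
have /choice[f' f'P] : forall s, exists r, A (h s) -> s <> \bot ->
    r < s /\ h r = f (h s).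
  move=> s; have [[As s0]|nAs] := pselect (A (h s) /\ s <> \bot); last first.
    by exists s => As s0; case: nAs.
  have hs0 : h s <> \bot.
    move=> hs; have : \bot < s by rewrite lt0x; apply/eqP.
    by move=> /hlt; rewrite hs ltx0.
  by have [r rs rE] := hon s _ (rf _ As hs0); exists r.
exists f'; split=> [s As s0|r]; first by have [] := f'P s As s0.
(* Regressivity says nothing at the root, which may thus fall into any fibre of [f']. *)
have s0 : special [set \bot : S].
  by apply: special_antichain => _ _ -> ->.
apply: special_subset (special_setU (special_preimage hlt (sf (h r))) s0).
move=> s [As /= sr]; have [->|/eqP s0'] := eqVneq s \bot; first by right.
by left; split=> //=; have [_ <-] := f'P s As s0'; rewrite sr.
Qed.

Lemma level_map_inj (h : S -> T) s r q : is_tree S -> level_map h ->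
  r <= s -> q <= s -> h r = h q -> r = q.
Proof.
move=> treeS [hlt _] rs qs hrq.
by case: (comparable_ltgtP (tree_comparable treeS rs qs)) => // /hlt;
  rewrite hrq ltxx.
Qed.

(** Inverting [h] below each node of the fibre gives an isomorphism from the predecessors of [t], so
    the fibre lies in one level of [S]. *)
Lemma level_map_countable (h : S -> T) t :
  is_omega1_tree S -> is_tree T -> level_map h -> countable (h @^-1` [set t]).
Proof.
move=> [treeS _ lvS] treeT hh; have [hlt hon] := hh.
pose W := below_order treeT t; pose v (w : W) : T := sval w.
have vt w : v w < t := svalP w.
apply: sub_countable (lvS d' W _); last exact: below_order_wo.
apply: subset_card_le => s /= st.
have /choice[g gP] : forall w : W, exists r, r < s /\ h r = v w.
  move=> w; have wt : v w < h s by rewrite st.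
  by have [r] := hon s _ wt; exists r.
have gmono : {mono g : x y / x <= y}.
  have ghomo : {homo g : x y / x < y}.
    move=> x y xy; have : v x < v y by exact: xy.
    rewrite -(gP x).2 -(gP y).2 => hxy.
    have [//|] := tree_ltVge treeS (ltW (gP x).1) (ltW (gP y).1).
    rewrite le_eqVlt => /orP[/eqP gxy|/hlt].
      by rewrite gxy ltxx in hxy.
    by move/(lt_trans hxy); rewrite ltxx.
  exact: le_mono.
exists g; split; last by move=> x y _ _; apply: leW_mono.
split=> [w _|x y _ _ gxy|r rs].
- exact: (gP w).1.
- exact: (inc_inj gmono).
- have rt : h r < t by rewrite -st; apply: hlt.
  exists (exist _ (h r) rt : W) => //.
  apply: (level_map_inj treeS hh (ltW (gP _).1) (ltW rs)).
  by rewrite (gP _).2.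
Qed.

Lemma diamond_level_map (h : S -> T) :
  is_omega1_tree S -> is_tree T -> level_map h -> diamond S -> diamond T.
Proof.
move=> o1S treeT hh [D [_ DP]].
have /choice[e eP] : forall t, exists e : S -> nat,
    {in h @^-1` [set t] &, injective e}.
  by move=> t; apply/countable_injP; apply: level_map_countable.
(* [e t] numbers the fibre over [t]; numbers not taken yield the empty guess. *)
pose A t n := [set x | exists2 s, h s = t /\ e t s = n & (h @` D s) x].
apply: (diamond_countable (A := A)) => // X NX.
apply: (DP (h @^-1` X)); apply: NS_subset (NS_preimage hh NX) => s /= DE.
exists (e (h s) s); apply/seteqP; split=> [x [Xx xs]|x [r [hr er] [q Dq <-]]].
  have [r rs rx] := hh.2 s x xs; exists s => //; exists r => //.
  by rewrite -DE /= rx.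
have rsE : r = s by apply: (eP (h s)) er; rewrite inE.
by move: Dq; rewrite rsE -DE => -[Xq qs]; split=> //; apply: hh.1.
Qed.

End LevelMap.

Theorem theorem3p17 (d d' : Order.disp_t)
    (S : bPOrderType d) (T : bPOrderType d')
    (treeS : is_tree S) (treeT : is_tree T)
    (htS : has_height_omega1 S) (htT : has_height_omega1 T)
    (leST : tree_le S T) :
  katetov_le (NS T) (NS S) /\
  (is_omega1_tree S -> nonspecial [set: S]%classic -> diamond S -> diamond T).
Proof.
have [h hh] := tree_le_level_map treeS treeT leST.
split=> [|o1S _]; last exact: diamond_level_map o1S treeT hh.
by exists h => A; apply: NS_preimage.
Qed.
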